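(* The following complex is a 4-periodic (free) resolution of the trivial module $\mathbb{Z}$ over $\mathbb{Z}[\mathcal{I}]$, where $\mathcal{I}$ is the binary icosahedral group: $$\cdots\to \mathbb{Z}[\mathcal{I}]^5\xrightarrow{\partial_{4q-3}}\mathbb{Z}[\mathcal{I}]\xrightarrow{\partial_{4q-4}}\cdots\to\mathbb{Z}[\mathcal{I}]^5\xrightarrow{\partial_2}\mathbb{Z}[\mathcal{I}]^5\xrightarrow{\partial_1}\mathbb{Z}[\mathcal{I}]\xrightarrow{\varepsilon}\mathbb{Z}\to0,$$ whose term in degree $m\ge0$ is $\mathbb{Z}[\mathcal{I}]$ if $m\equiv0,3\pmod4$ and $\mathbb{Z}[\mathcal{I}]^5$ if $m\equiv1,2\pmod4$, where $\varepsilon$ is the augmentation and, for $q\ge1$, $$\partial_{4q-3}=\begin{pmatrix}\sigma_k^+-1 \\ \sigma_i^+-1 \\ \sigma_j^+-1 \\ \sigma_j^--1 \\ \sigma_i^--1\end{pmatrix},\quad\partial_{4q-2}=\begin{pmatrix}\sigma_j^- & 0 & 0 & 1 & -1 \\ -1 & \sigma_i^- & 0 & 0 & 1 \\ 1 & -1 & \sigma_k^+ & 0 & 0 \\ 0 & 1 & -1 & \sigma_i^+ & 0 \\ 0 & 0 & 1 & -1 & \sigma_j^+\end{pmatrix},$$ $$\partial_{4q-1}=\begin{pmatrix}\sigma_i^+-1 & \sigma_j^+-1 & \sigma_j^--1 & \sigma_i^--1 & \sigma_k^+-1\end{pmatrix},\quad\partial_{4q}=\begin{pmatrix}\sum_{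g\in\mathcal{I}}g\end{pmatrix}.$$
   Context: Let $\varphi=\frac{1+\sqrt5}{2}$. $\mathcal{I}$ is the subgroup of order 120 of the group of unit quaternions generated by $i$ and $\frac12(\varphi^{-1}+i+\varphi j)$. Put $\sigma_i^\pm=\frac{\varphi+\varphi^{-1}i\pm j}{2}$, $\sigma_j^\pm=\frac{\varphi\pm\varphi^{-1}j-k}{2}$, $\sigma_k^\pm=\frac{\varphi+i\pm\varphi^{-1}k}{2}$; all lie in $\mathcal{I}$. In the matrices, sums and differences are taken in the group ring $\mathbb{Z}[\mathcal{I}]$ and $\pm1$ means $\pm$ its unit. The augmentation is $\varepsilon(\sum_ga_gg)=\sum_ga_g$. Modules are left modules; a homomorphism $\mathbb{Z}[\mathcal{I}]^m\to\mathbb{Z}[\mathcal{I}]^n$ is given by an $m\times n$ matrix acting on row vectors by right multiplication. *)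

(* Defs.v *)
From HB Require Import structures.
From mathcomp Require Import all_boot all_order all_algebra all_fingroup.
From mathcomp Require Import boolp reals.
From mathcomp Require Import ring lra.

Set Implicit Arguments.
Unset Strict Implicit.
Unset Printing Implicit Defensive.

Import Order.TTheory GRing.Theory Num.Theory.
Local Open Scope ring_scope.

Section GroupRing.
Variable gT : finGroupType.

Definition Zgroup_ring := {ffun gT -> int}.

HB.instance Definition _ := GRing.Zmodule.on Zgroup_ring.

Definition gr_elt (g : gT) : Zgroup_ring := [ffun h => (h == g)%:R].

Definition gr_mul (a b : Zgroup_ring) : Zgroup_ring :=
  [ffun g => \sum_h a h * b (h^-1 * g)%g].

Lemma gr_mulE (a b : Zgroup_ring) g :
  gr_mul a b g = \sum_h a h * b (h^-1 * g)%g.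
Proof. by rewrite ffunE. Qed.

Fact gr_mulA : associative gr_mul.
Proof.
move=> a b c; apply/ffunP=> g; rewrite !gr_mulE.
transitivity (\sum_h \sum_k a h * (b (h^-1 * k)%g * c (k^-1 * g)%g)).
  apply: eq_bigr => h _; rewrite gr_mulE big_distrr /=.
  rewrite (reindex_inj (mulgI h^-1%g)) /=; apply: eq_bigr => k _.
  by rewrite invMg invgK -mulgA mulKVg.
rewrite exchange_big /=; apply: eq_bigr => k _.
by rewrite gr_mulE big_distrl /=; apply: eq_bigr => h _; rewrite mulrA.
Qed.

Fact gr_mul1l : left_id (gr_elt 1%g) gr_mul.
Proof.
move=> a; apply/ffunP=> g; rewrite gr_mulE (bigD1 1%g) //= big1 => [|h hn1].
  by rewrite ffunE eqxx mul1r invg1 mul1g addr0.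
by rewrite ffunE (negPf hn1) mul0r.
Qed.

Fact gr_mul1r : right_id (gr_elt 1%g) gr_mul.
Proof.
move=> a; apply/ffunP=> g; rewrite gr_mulE (bigD1 g) //= big1 => [|h hng].
  by rewrite ffunE mulVg eqxx mulr1 addr0.
by rewrite ffunE -eq_mulVg1 (negPf hng) mulr0.
Qed.

Fact gr_mulDl : left_distributive gr_mul +%R.
Proof.
move=> a b c; apply/ffunP=> g; rewrite [RHS]ffunE !gr_mulE -big_split /=.
by apply: eq_bigr => h _; rewrite ffunE mulrDl.
Qed.

Fact gr_mulDr : right_distributive gr_mul +%R.
Proof.
move=> a b c; apply/ffunP=> g; rewrite [RHS]ffunE !gr_mulE -big_split /=.
by apply: eq_bigr => h _; rewrite ffunE mulrDr.
Qed.

Fact gr_one_neq0 : gr_elt 1%g != 0.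
Proof. by apply/eqP => /ffunP/(_ 1%g); rewrite !ffunE eqxx. Qed.

HB.instance Definition _ := GRing.Zmodule_isNzRing.Build Zgroup_ring
  gr_mulA gr_mul1l gr_mul1r gr_mulDl gr_mulDr gr_one_neq0.

Lemma gr_eltM g h : gr_elt (g * h)%g = gr_elt g * gr_elt h.
Proof.
apply/ffunP=> k; rewrite gr_mulE (bigD1 g) //= big1 => [|x /negPf xg].
  by rewrite !ffunE eqxx mul1r addr0 -(inj_eq (mulgI g^-1%g)) mulKg.
by rewrite ffunE xg mul0r.
Qed.

Definition augmentation (a : Zgroup_ring) : int := \sum_g a g.

Lemma augmentationD : {morph augmentation : a b / a + b}.
Proof. by move=> a b; rewrite -big_split; apply: eq_bigr => g _; rewrite ffunE. Qed.

Lemma augmentationM : {morph augmentation : a b / a * b}.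
Proof.
move=> a b; rewrite /augmentation big_distrl /=.
under eq_bigr => g _ do rewrite gr_mulE.
rewrite exchange_big /=; apply: eq_bigr => h _.
rewrite big_distrr /= (reindex_inj (mulgI h)) /=.
by apply: eq_bigr => g _; rewrite mulKg.
Qed.

Lemma augmentation_elt g : augmentation (gr_elt g) = 1.
Proof.
rewrite /augmentation (bigD1 g) //= big1 => [|h hng].
  by rewrite ffunE eqxx addr0.
by rewrite ffunE (negPf hng).
Qed.

End GroupRing.

(* The trivial module: Z with every g acting as the identity, so that an     *)
(* arbitrary element of the group ring acts through its augmentation.        *)
Definition trivial_Z (gT : finGroupType) : Type := int.

HB.instance Definition _ (gT : finGroupType) :=
  GRing.Zmodule.on (trivial_Z gT).

Section TrivialModule.
Variable gT : finGroupType.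

Definition trivial_scale (a : (Zgroup_ring gT)) (x : (trivial_Z gT)) : (trivial_Z gT) :=
  augmentation a * (x : int).

Fact trivial_scaleA a b x :
  trivial_scale a (trivial_scale b x) = trivial_scale (a * b) x.
Proof. by rewrite /trivial_scale augmentationM mulrA. Qed.
Fact trivial_scale1 : left_id 1 trivial_scale.
Proof. by move=> x; rewrite /trivial_scale augmentation_elt mul1r. Qed.
Fact trivial_scaleDr : right_distributive trivial_scale +%R.
Proof. by move=> a x y; rewrite /trivial_scale mulrDr. Qed.
Fact trivial_scaleDl x : {morph trivial_scale^~ x : a b / a + b}.
Proof. by move=> a b; rewrite /trivial_scale augmentationD mulrDl. Qed.

HB.instance Definition _ := GRing.Zmodule_isLmodule.Build (Zgroup_ring gT) (trivial_Z gT)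
  trivial_scaleA trivial_scale1 trivial_scaleDr trivial_scaleDl.

Lemma trivial_scale_elt g (x : (trivial_Z gT)) : gr_elt g *: x = x.
Proof. by rewrite /GRing.scale /= /trivial_scale augmentation_elt mul1r. Qed.

Definition aug_row (v : 'rV[Zgroup_ring gT]_1) : (trivial_Z gT) := augmentation (v 0 0).

Fact aug_row_is_linear : linear aug_row.
Proof.
move=> a u v; rewrite /aug_row !mxE augmentationD augmentationM.
by rewrite /GRing.scale.
Qed.

HB.instance Definition _ := GRing.isLinear.Build (Zgroup_ring gT) 'rV[Zgroup_ring gT]_1
  (trivial_Z gT) _ aug_row aug_row_is_linear.

End TrivialModule.

Section Resolutions.
Variable A : nzRingType.

(* Free left modules are row spaces 'rV[A]_(r n), and d n (right             *)
(* multiplication by a matrix) goes from degree n.+1 to degree n.            *)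
Record free_resolution (M : lmodType A) (r : nat -> nat)
    (d : forall n, 'M[A]_(r n.+1, r n)) (e : {linear 'rV[A]_(r 0) -> M}) :
    Prop := FreeResolution {
  resolution_surj : forall x : M, exists v, e v = x;
  resolution_exact0 :
    forall v : 'rV[A]_(r 0), e v = 0 <-> exists u, u *m d 0 = v;
  resolution_exact : forall n (v : 'rV[A]_(r n.+1)),
    v *m d n = 0 <-> exists u, u *m d n.+1 = v }.

Definition periodic_complex (p : nat) (r : nat -> nat)
    (d : forall n, 'M[A]_(r n.+1, r n)) : Prop :=
  exists E : forall n, r (n + p)%N = r n,
  forall n, castmx (E n.+1, E n) (d (n + p)%N) = d n.

Definition mx_of_rows m n (s : seq (seq A)) : 'M[A]_(m, n) :=
  \matrix_(i < m, j < n) nth 0 (nth [::] s i) j.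

End Resolutions.

Section GeneratedSubgroup.
Variables (G : groupType) (A : {pred G}).

Definition generated : {pred G} := fun x =>
  `[< forall H : {pred G}, group_closed H -> {subset A <= H} -> x \in H >].

Lemma generatedP x :
  reflect (forall H : {pred G}, group_closed H -> {subset A <= H} -> x \in H)
          (x \in generated).
Proof. exact: asboolP. Qed.

Lemma generated_closed : group_closed generated.
Proof.
split=> [|x y /generatedP Hx /generatedP Hy]; apply/generatedP=> H HH sAH.
  by case: HH.
by case: (HH) => _; apply; [apply: Hx | apply: Hy].
Qed.

Lemma sub_generated : {subset A <= generated}.
Proof. by move=> x Ax; apply/generatedP=> H _; apply. Qed.

End GeneratedSubgroup.

Record quat (R : Type) := Quat { qr : R; qi : R; qj : R; qk : R }.

Section QuatChoice.
Variable R : choiceType.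
Definition quat_prod (q : quat R) := (qr q, qi q, qj q, qk q).
Definition prod_quat (p : R * R * R * R) :=
  let: (a, b, c, d) := p in Quat a b c d.
Fact quat_prodK : cancel quat_prod prod_quat. Proof. by case. Qed.
HB.instance Definition _ := Choice.copy (quat R) (can_type quat_prodK).
End QuatChoice.

Section UnitQuaternions.
Variable R : comNzRingType.
Implicit Types p q : quat R.

Definition mulq p q : quat R := Quat
  (qr p * qr q - qi p * qi q - qj p * qj q - qk p * qk q)
  (qr p * qi q + qi p * qr q + qj p * qk q - qk p * qj q)
  (qr p * qj q - qi p * qk q + qj p * qr q + qk p * qi q)
  (qr p * qk q + qi p * qj q - qj p * qi q + qk p * qr q).
Definition oneq : quat R := Quat 1 0 0 0.
Definition conjq q : quat R := Quat (qr q) (- qi q) (- qj q) (- qk q).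
Definition normq q : R := qr q ^+ 2 + qi q ^+ 2 + qj q ^+ 2 + qk q ^+ 2.

Fact mulqA : associative mulq.
Proof. by move=> [? ? ? ?] [? ? ? ?] [? ? ? ?]; congr Quat => /=; ring. Qed.
Fact mul1q : left_id oneq mulq.
Proof. by move=> [? ? ? ?]; congr Quat => /=; ring. Qed.
Fact mulq1 : right_id oneq mulq.
Proof. by move=> [? ? ? ?]; congr Quat => /=; ring. Qed.
Fact mulVq q : mulq (conjq q) q = Quat (normq q) 0 0 0.
Proof. by case: q => [? ? ? ?]; congr Quat => /=; rewrite /normq /=; ring. Qed.
Fact mulqV q : mulq q (conjq q) = Quat (normq q) 0 0 0.
Proof. by case: q => [? ? ? ?]; congr Quat => /=; rewrite /normq /=; ring. Qed.
Fact normqM p q : normq (mulq p q) = normq p * normq q.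
Proof. by rewrite /normq /=; ring. Qed.
Fact normqV q : normq (conjq q) = normq q.
Proof. by rewrite /normq /=; ring. Qed.
Fact normq1 : normq oneq == 1.
Proof. by apply/eqP; rewrite /normq /=; ring. Qed.

Record uquat := UQuat { uquat_val :> quat R; _ : normq uquat_val == 1 }.
HB.instance Definition _ := [isSub for uquat_val].
HB.instance Definition _ := [Choice of uquat by <:].

Fact uquat_mul_subproof (p q : uquat) : normq (mulq p q) == 1.
Proof. by rewrite normqM (eqP (valP p)) (eqP (valP q)) mulr1. Qed.
Fact uquat_inv_subproof (q : uquat) : normq (conjq q) == 1.
Proof. by rewrite normqV (valP q). Qed.

Definition uquat_mul (p q : uquat) := UQuat (uquat_mul_subproof p q).
Definition uquat_one := UQuat normq1.
Definition uquat_inv (q : uquat) := UQuat (uquat_inv_subproof q).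

Fact uquat_mulA : associative uquat_mul.
Proof. by move=> p q s; apply: val_inj; rewrite /= mulqA. Qed.
Fact uquat_mul1l : left_id uquat_one uquat_mul.
Proof. by move=> p; apply: val_inj; rewrite /= mul1q. Qed.
Fact uquat_mul1r : right_id uquat_one uquat_mul.
Proof. by move=> p; apply: val_inj; rewrite /= mulq1. Qed.
Fact uquat_mulVl : left_inverse uquat_one uquat_inv uquat_mul.
Proof. by move=> p; apply: val_inj; rewrite /= mulVq (eqP (valP p)). Qed.
Fact uquat_mulVr : right_inverse uquat_one uquat_inv uquat_mul.
Proof. by move=> p; apply: val_inj; rewrite /= mulqV (eqP (valP p)). Qed.

HB.instance Definition _ := isGroup.Build uquat uquat_mulA
  uquat_mul1l uquat_mul1r uquat_mulVl uquat_mulVr.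

End UnitQuaternions.

(* Exact arithmetic used to enumerate the group: (a, b) stands for           *)
(* (a + b phi) / 2, and a quadruple of such pairs for a quaternion. The two  *)
(* products below represent twice the actual product, which is why           *)
(* gquat_step halves (keeping only exact halves).                            *)
Definition gold : Type := (int * int)%type.
Definition gquat : Type := (gold * gold * gold * gold)%type.

Definition gold_add (x y : gold) : gold := (x.1 + y.1, x.2 + y.2).
Definition gold_opp (x : gold) : gold := (- x.1, - x.2).
Definition gold_mul (x y : gold) : gold :=
  (x.1 * y.1 + x.2 * y.2, x.1 * y.2 + x.2 * y.1 + x.2 * y.2).

Definition gquat_mul (p q : gquat) : gquat :=
  let: (a, b, c, d) := p in let: (a', b', c', d') := q in
  let s x y z t u v w r := gold_add (gold_add (gold_mul x y) (gold_mul z t))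
                             (gold_add (gold_mul u v) (gold_mul w r)) in
  let n := gold_opp in
  (s a a' (n b) b' (n c) c' (n d) d',
   s a b' b a' c d' (n d) c',
   s a c' (n b) d' c a' d b',
   s a d' b c' (n c) b' d a').

Definition gquat_double (p : gquat) : gquat :=
  let: (a, b, c, d) := p in
  (gold_add a a, gold_add b b, gold_add c c, gold_add d d).

Definition int_half (n : int) : int :=
  match n with Posz m => Posz m./2 | Negz m => Negz m./2 end.
Definition gold_half (x : gold) : gold := (int_half x.1, int_half x.2).
Definition gquat_half (p : gquat) : gquat :=
  let: (a, b, c, d) := p in
  (gold_half a, gold_half b, gold_half c, gold_half d).

Definition gquat_1 : gquat := ((2, 0), (0, 0), (0, 0), (0, 0)).
Definition gquat_i : gquat := ((0, 0), (2, 0), (0, 0), (0, 0)).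
Definition gquat_w : gquat := ((- 1, 1), (1, 0), (0, 1), (0, 0)).

Definition gquat_step (s : seq gquat) : seq gquat :=
  undup (s ++ [seq gquat_half m |
               m <- [seq gquat_mul p g | p <- s, g <- [:: gquat_i; gquat_w]]
               & gquat_double (gquat_half m) == m]).

HB.lock Definition gquat_icos : seq gquat := iter 12 gquat_step [:: gquat_1].

Lemma size_gquat_icos : size gquat_icos = 120%N.
Proof. by rewrite gquat_icos.unlock; vm_compute. Qed.

Definition gquat_closed (s : seq gquat) : bool :=
  all (fun p => all (fun g => has (fun q => gquat_double q == gquat_mul p g) s)
                    [:: gquat_i; gquat_w]) s.

Lemma gquat_icos_closed : gquat_closed gquat_icos.
Proof. by rewrite gquat_icos.unlock; vm_compute. Qed.

Lemma gquat_icos_uniq : uniq gquat_icos.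
Proof. by rewrite gquat_icos.unlock iterS undup_uniq. Qed.

Lemma gquat_1_icos : gquat_1 \in gquat_icos.
Proof. by rewrite gquat_icos.unlock; vm_compute. Qed.

Definition gquat_sigma_i (b : bool) : gquat :=
  ((0, 1), (- 1, 1), ((-1) ^+ b, 0), (0, 0)).
Definition gquat_sigma_j (b : bool) : gquat :=
  ((0, 1), (0, 0), (- (-1) ^+ b, (-1) ^+ b), (- 1, 0)).
Definition gquat_sigma_k (b : bool) : gquat :=
  ((0, 1), (1, 0), (0, 0), (- (-1) ^+ b, (-1) ^+ b)).

Definition gquat_sigmas : seq gquat :=
  [seq f b | f <- [:: gquat_sigma_i; gquat_sigma_j; gquat_sigma_k],
             b <- [:: false; true]].

Lemma gquat_sigmas_icos : all (mem gquat_icos) gquat_sigmas.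
Proof. by rewrite gquat_icos.unlock; vm_compute. Qed.

Section Icosahedral.
Variable R : realType.

Definition phi : R := (1 + Num.sqrt 5) / 2.

Lemma phi_gt1 : 1 < phi.
Proof.
have h : 1 < Num.sqrt 5 :> R by rewrite -[ltLHS]sqrtr1 ltr_sqrt // ltr1n.
by rewrite /phi; lra.
Qed.

Lemma phi_sqr : phi ^+ 2 = phi + 1.
Proof.
have h : Num.sqrt 5 ^+ 2 = 5 :> R by rewrite sqr_sqrtr.
by apply/eqP; rewrite -subr_eq0 /phi; apply/eqP; field: h.
Qed.

Lemma phi_inv : phi^-1 = phi - 1.
Proof.
have h := phi_gt1; have phi0 : phi != 0 by rewrite gt_eqF //; lra.
apply: (mulfI phi0); rewrite mulfV //.
by have := phi_sqr; rewrite expr2 => e; rewrite mulrBr e; ring.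
Qed.

Definition quat_i : quat R := Quat 0 1 0 0.
Definition quat_w : quat R := Quat (phi^-1 / 2) (1 / 2) (phi / 2) 0.

Fact quat_i_unit : normq quat_i == 1.
Proof. by apply/eqP; rewrite /normq /=; ring. Qed.
Fact quat_w_unit : normq quat_w == 1.
Proof.
by apply/eqP; rewrite /normq /= phi_inv; field: phi_sqr.
Qed.

(* Coordinates of sigma_i^+, sigma_i^-, ...; the boolean is true for the     *)
(* sign -.                                                                   *)
Definition quat_sigma_i (b : bool) : quat R :=
  Quat (phi / 2) (phi^-1 / 2) ((-1) ^+ b / 2) 0.
Definition quat_sigma_j (b : bool) : quat R :=
  Quat (phi / 2) 0 ((-1) ^+ b * phi^-1 / 2) (- 1 / 2).
Definition quat_sigma_k (b : bool) : quat R :=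
  Quat (phi / 2) (1 / 2) 0 ((-1) ^+ b * phi^-1 / 2).

Definition icos_gens : {pred uquat R} :=
  pred2 (UQuat quat_i_unit) (UQuat quat_w_unit).

Record icos := Icos { icos_val :> uquat R; _ : icos_val \in generated icos_gens }.
HB.instance Definition _ := [isSub for icos_val].
HB.instance Definition _ := [Choice of icos by <:].
HB.instance Definition _ := SubChoice_isSubGroup.Build (uquat R)
  (generated icos_gens) icos (generated_closed icos_gens).


Definition gold_val (x : gold) : R := (x.1%:~R + x.2%:~R * phi) / 2.
Definition gquat_val (p : gquat) : quat R :=
  let: (a, b, c, d) := p in
  Quat (gold_val a) (gold_val b) (gold_val c) (gold_val d).

Lemma gquat_valM p g q : gquat_double q = gquat_mul p g ->
  mulq (gquat_val p) (gquat_val g) = gquat_val q.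
Proof.
have valD x y : gold_val (gold_add x y) = gold_val x + gold_val y.
  by rewrite /gold_val /= !rmorphD /=; field.
have valN x : gold_val (gold_opp x) = - gold_val x.
  by rewrite /gold_val /= !rmorphN /=; field.
have valM x y : gold_val (gold_mul x y) = 2 * (gold_val x * gold_val y).
  by rewrite /gold_val /= !rmorphD /= !rmorphM /=; field: phi_sqr.
case: p g q => [[[a b] c] d] [[[a' b'] c'] d'] [[[a1 b1] c1] d1].
move=> e.
have := congr1 (fun r => gold_val r.1.1.1) e.
have := congr1 (fun r => gold_val r.1.1.2) e.
have := congr1 (fun r => gold_val r.1.2) e.
have := congr1 (fun r => gold_val r.2) e.
rewrite [gquat_mul _ _]/= [gquat_double _]/= [_.2]/= [_.1]/=.
rewrite !(valD, valN, valM) => ed ec eb ea.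
by congr Quat => /=; lra.
Qed.

Lemma gquat_val_1 : gquat_val gquat_1 = oneq R.
Proof. by congr Quat; rewrite /gold_val /=; field. Qed.
Lemma gquat_val_i : gquat_val gquat_i = quat_i.
Proof. by congr Quat; rewrite /gold_val /=; field. Qed.
Lemma gquat_val_w : gquat_val gquat_w = quat_w.
Proof. by congr Quat; rewrite /gold_val ?phi_inv /=; field. Qed.

Lemma phi_irrational (a b : int) : a%:~R + b%:~R * phi = 0 -> (a, b) = (0, 0).
Proof.
move=> e; suff b0 : b = 0.
  by move: e; rewrite b0 mul0r addr0 => /eqP; rewrite intr_eq0 => /eqP ->.
have : (a ^+ 2 + a * b - b ^+ 2)%:~R = 0 :> R.
  rewrite rmorphB rmorphD !rmorphXn rmorphM /=.
  have -> : a%:~R = - (b%:~R * phi) by lra.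
  transitivity (b%:~R ^+ 2 * (phi ^+ 2 - (phi + 1))); first by ring.
  by rewrite phi_sqr subrr mulr0.
move/eqP; rewrite intr_eq0 => /eqP eab.
have : (2 * a + b) ^+ 2 = 5 * b ^+ 2.
  apply/eqP; rewrite -subr_eq0; apply/eqP.
  transitivity (4 * (a ^+ 2 + a * b - b ^+ 2)); first by ring.
  by rewrite eab mulr0.
move/(congr1 absz); rewrite !(abszX, abszM) /=.
move: (absz _) => m e2; apply/eqP; rewrite -absz_eq0; move: (absz b) e2 => n.
case: n => // n /(congr1 (logn 5)).
rewrite lognM ?expn_gt0 // !lognX => /(congr1 odd).
by rewrite oddD !oddM.
Qed.

Lemma gold_val_inj : injective gold_val.
Proof.
move=> [a b] [a' b']; rewrite /gold_val /= => e.
have /phi_irrational : (a - a')%:~R + (b - b')%:~R * phi = 0.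
  by rewrite !rmorphB /=; lra.
by case=> /subr0_eq -> /subr0_eq ->.
Qed.

Lemma gquat_val_inj : injective gquat_val.
Proof.
move=> [[[a b] c] d] [[[a' b'] c'] d'] [].
by do 4!move/gold_val_inj => ->.
Qed.

Definition quat_icos : seq (quat R) := map gquat_val gquat_icos.

Lemma quat_icos_uniq : uniq quat_icos.
Proof. by rewrite map_inj_uniq ?gquat_icos_uniq //; apply: gquat_val_inj. Qed.

Lemma oneq_quat_icos : oneq R \in quat_icos.
Proof. by rewrite -gquat_val_1; apply: map_f; apply: gquat_1_icos. Qed.

Lemma generated_quat_icos (x : uquat R) :
  x \in generated icos_gens -> uquat_val x \in quat_icos.
Proof.
pose H : {pred uquat R} :=
  fun y => all (fun s => mulq s (uquat_val y) \in quat_icos) quat_icos.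
move=> /generatedP/(_ H) Hx; suff /allP/(_ _ oneq_quat_icos): x \in H.
  by rewrite mul1q.
apply: Hx.
  split; first by apply/allP=> s sS; rewrite /= mulq1.
  move=> y z /allP Hy /allP Hz; apply/allP=> s sS.
  have zV : cancel (fun q => mulq q (uquat_val z))
                   (fun q => mulq q (conjq (uquat_val z))).
    by move=> q; rewrite -mulqA mulqV (eqP (valP z)) mulq1.
  have zinj := can_inj zV.
  pose T := [seq mulq q (uquat_val z) | q <- quat_icos].
  have Tuniq : uniq T by rewrite map_inj_uniq ?quat_icos_uniq.
  have sT : {subset T <= quat_icos} by move=> _ /mapP[q qS ->]; apply: Hz.
  have szT : (size quat_icos <= size T)%N by rewrite [size T]size_map leqnn.
  have [_ eT] := uniq_min_size Tuniq sT szT.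
  have := Hy _ sS; rewrite -eT.
  by case/mapP=> q qS e /=; rewrite mulqA e zV.
have clos p g : p \in gquat_icos -> g \in [:: gquat_i; gquat_w] ->
    mulq (gquat_val p) (gquat_val g) \in quat_icos.
  move=> pS gS; have /allP/(_ _ pS)/allP/(_ _ gS)/hasP[q qS /eqP e] :=
    gquat_icos_closed.
  by rewrite (gquat_valM e); apply: map_f.
move=> y /orP[] /eqP -> ; apply/allP=> _ /mapP[p pS ->] /=.
  by rewrite -gquat_val_i clos // mem_head.
by rewrite -gquat_val_w clos // in_cons mem_head orbT.
Qed.

Lemma quat_icos_generated q : q \in quat_icos ->
  exists2 x : uquat R, x \in generated icos_gens & uquat_val x = q.
Proof.
have [gen1 genV] := generated_closed icos_gens.
have genM := group_closedM (generated_closed icos_gens).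
case/mapP=> p; rewrite gquat_icos.unlock; elim: 12%N p q => [|n IH] p q.
  by rewrite inE => /eqP-> ->; exists 1%g; rewrite ?gquat_val_1.
rewrite iterS mem_undup mem_cat => /orP[/IH|]; first by apply.
case/mapP=> m; rewrite mem_filter => /andP[/eqP em].
case/allpairsP=> -[r g] [/= rS gS e] ep eq.
have [x xG ex] := IH _ _ rS erefl.
have [y yG ey] : exists2 y : uquat R, y \in generated icos_gens
    & uquat_val y = gquat_val g.
  move: gS; rewrite !inE => /orP[]/eqP->.
    exists (UQuat quat_i_unit); last by rewrite gquat_val_i.
    by apply: sub_generated; rewrite !inE eqxx.
  exists (UQuat quat_w_unit); last by rewrite gquat_val_w.
  by apply: sub_generated; rewrite !inE eqxx orbT.
exists (x * y)%g; first exact: genM.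
by rewrite /= ex ey eq ep; apply: gquat_valM; rewrite em.
Qed.

Lemma icos_val_quat_icos (g : icos) : uquat_val g \in quat_icos.
Proof. by case: g => x /= xG; apply: generated_quat_icos. Qed.

Definition icos_to_seq (g : icos) : seq_sub quat_icos :=
  SeqSub (icos_val_quat_icos g).
Definition seq_to_icos (q : seq_sub quat_icos) : icos :=
  let: exist2 x xG _ := cid2 (quat_icos_generated (valP q)) in Icos xG.
Lemma icos_to_seqK : cancel icos_to_seq seq_to_icos.
Proof.
move=> g; rewrite /seq_to_icos; case: cid2 => x xG ex.
by do 2!apply: val_inj.
Qed.

HB.instance Definition _ := Countable.copy icos (can_type icos_to_seqK).
HB.instance Definition _ : isFinite icos := CanIsFinite icos_to_seqK.

Lemma card_icos : #|{: icos}| = 120%N.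
Proof.
have vinj : injective (fun g : icos => uquat_val g).
  by move=> g h e; do 2!apply: val_inj.
rewrite -(size_codom (fun g : icos => uquat_val g)) -size_gquat_icos.
rewrite -(size_map gquat_val); apply/perm_size/uniq_perm.
- exact/injectiveP.
- exact: quat_icos_uniq.
move=> q; apply/codomP/idP => [[g ->]|/quat_icos_generated[x xG <-]].
  exact: icos_val_quat_icos.
by exists (Icos xG).
Qed.

Fact sigma_i_unit b : normq (quat_sigma_i b) == 1.
Proof.
by case: b; apply/eqP; rewrite /normq /= phi_inv; field: phi_sqr.
Qed.
Fact sigma_j_unit b : normq (quat_sigma_j b) == 1.
Proof.
by case: b; apply/eqP; rewrite /normq /= phi_inv; field: phi_sqr.
Qed.
Fact sigma_k_unit b : normq (quat_sigma_k b) == 1.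
Proof.
by case: b; apply/eqP; rewrite /normq /= phi_inv; field: phi_sqr.
Qed.

Lemma gquat_generated p (x : uquat R) : p \in gquat_sigmas ->
  gquat_val p = x -> x \in generated icos_gens.
Proof.
move=> pS ex; have [|y yG ey] := @quat_icos_generated (gquat_val p).
  by apply: map_f; apply: (allP gquat_sigmas_icos).
by rewrite -(_ : y = x) //; apply: val_inj; rewrite /= ey.
Qed.

Fact sigma_i_icos b : UQuat (sigma_i_unit b) \in generated icos_gens.
Proof.
apply: (@gquat_generated (gquat_sigma_i b)); first by case: b.
by congr Quat; case: b; rewrite /gold_val ?phi_inv /=; field.
Qed.
Fact sigma_j_icos b : UQuat (sigma_j_unit b) \in generated icos_gens.
Proof.
apply: (@gquat_generated (gquat_sigma_j b)); first by case: b.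
by congr Quat; case: b; rewrite /gold_val ?phi_inv /=; field.
Qed.
Fact sigma_k_icos b : UQuat (sigma_k_unit b) \in generated icos_gens.
Proof.
apply: (@gquat_generated (gquat_sigma_k b)); first by case: b.
by congr Quat; case: b; rewrite /gold_val ?phi_inv /=; field.
Qed.

Definition sigma_i b : icos := Icos (sigma_i_icos b).
Definition sigma_j b : icos := Icos (sigma_j_icos b).
Definition sigma_k b : icos := Icos (sigma_k_icos b).

End Icosahedral.

Section IcosahedralResolution.
Variable R : realType.

Local Notation A := (Zgroup_ring (icos R)).
Local Notation "''i+'" := (gr_elt (sigma_i R false) : A).
Local Notation "''i-'" := (gr_elt (sigma_i R true) : A).
Local Notation "''j+'" := (gr_elt (sigma_j R false) : A).
Local Notation "''j-'" := (gr_elt (sigma_j R true) : A).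
Local Notation "''k+'" := (gr_elt (sigma_k R false) : A).

Definition icos_d1 : 'M[A]_(5, 1) := mx_of_rows 5 1
  [:: [:: 'k+ - 1];
      [:: 'i+ - 1];
      [:: 'j+ - 1];
      [:: 'j- - 1];
      [:: 'i- - 1]].

Definition icos_d2 : 'M[A]_(5, 5) := mx_of_rows 5 5
  [:: [:: 'j-;  0;   0;   1;   -1];
      [:: -1;   'i-; 0;   0;   1];
      [:: 1;    -1;  'k+; 0;   0];
      [:: 0;    1;   -1;  'i+; 0];
      [:: 0;    0;   1;   -1;  'j+]].

Definition icos_d3 : 'M[A]_(1, 5) := mx_of_rows 1 5
  [:: [:: 'i+ - 1; 'j+ - 1; 'j- - 1; 'i- - 1; 'k+ - 1]].

Definition icos_d4 : 'M[A]_(1, 1) := mx_of_rows 1 1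
  [:: [:: \sum_(g : icos R) gr_elt g]].

Fixpoint icos_rank (m : nat) : nat :=
  match m with
  | 0 => 1
  | 1 => 5
  | 2 => 5
  | 3 => 1
  | m'.+4 => icos_rank m'
  end.

(* icos_d n is the differential from degree n.+1 to degree n, the (n + 1)-st *)
(* of the sequence.                                                          *)
Fixpoint icos_d (n : nat) : 'M[A]_(icos_rank n.+1, icos_rank n) :=
  match n with
  | 0 => icos_d1
  | 1 => icos_d2
  | 2 => icos_d3
  | 3 => icos_d4
  | n'.+4 => icos_d n'
  end.

Definition icos_aug : {linear 'rV[A]_(icos_rank 0) -> trivial_Z (icos R)} :=
  @aug_row (icos R).

End IcosahedralResolution.

(* Main.v *)
Require Import Defs.
From mathcomp Require Import all_boot all_order all_algebra all_fingroup.
From mathcomp Require Import reals.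
From mathcomp Require Import ring.

(** Write s_i, for i in Z/5, for sigma_k^+, sigma_i^+, sigma_j^+, sigma_j^-,
    sigma_i^- in this order. Then s_(i+3) s_i = s_(i+4), and in terms of the
    s_i all differentials are invariant under i |-> i+1: the entries of d1 are
    s_i - 1, row i of d2 is s_(i+3) e_i + e_(i+3) - e_(i+4), the entries of d3
    are s_(i+1) - 1, and d4 is the norm element N.

    The rows of d2 record the three sides of the triangle that spells the
    relation s_(i+3) s_i = s_(i+4). So d2 and d1 are the boundary maps of the
    Cayley 2-complex of the group with respect to these generators and
    relations, which form Sieradski's presentation of the binary icosahedral
    group. Exactness follows from two properties of this 2-complex: it is
    connected (Cayley_connected), and each 1-cocycle with coefficients in any
    abelian group is a coboundary (cocycle_is_coboundary).

    - Degree 0: g - 1 lies in the image of d1 for all g, by connectedness, and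
      these elements span the kernel of the augmentation epsilon.
    - Degree 1: g e_i, as a function of the edge (g, i), is a cocycle with
      values in the cokernel of d2. Writing it as a coboundary shows that each
      cycle vanishes in that cokernel.
    - Degree 2: conjugation by some element q of the group sends s_i to
      s_(1-i)^-1. This identifies the complex with its own dual, up to
      i |-> -i. A 2-cycle becomes an integral 1-cocycle, and a function with
      that coboundary is a preimage under d3.
    - Degree 3: the kernel of d3 consists of the functions that are invariant
      under all s_i. By connectedness these are the multiples of N.
    - Degree 4: x N = epsilon(x) N, so the kernel of d4 is the augmentation
      ideal, where the complex starts again.

    The two properties of the 2-complex come from a finite computation: a
    spanning tree gives a potential that accounts for the value of a cocycle on
    the edges of the tree, and the cocycle condition on a triangle extends this
    from two of its sides to the third. Starting from the tree, the triangles
    reach all 600 edges. *)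

Set Implicit Arguments.
Unset Strict Implicit.
Unset Printing Implicit Defensive.

Import GRing.Theory.
Local Open Scope ring_scope.

(** * Spanning trees and triangles in a Cayley graph *)

Section EdgeSets.

(** The edge i out of the vertex v is the pair (v, i). A set of edges is a table
    of booleans, which keeps lookup cheap in the evaluation further down. *)
Definition known (K : seq (seq bool)) (v i : nat) : bool :=
  nth false (nth [::] K v) i.

Definition mark (K : seq (seq bool)) (v i : nat) : seq (seq bool) :=
  set_nth [::] K v (set_nth false (nth [::] K v) i true).

Lemma known_mark K v i w j :
  known (mark K v i) w j = (w == v) && (j == i) || known K w j.
Proof.
rewrite /known /mark nth_set_nth /=; case: (w =P v) => //= ->.
by rewrite nth_set_nth /=; case: (j == i).
Qed.

Lemma foldl_invariant S (E : eqType) (I : S -> Prop) (f : S -> E -> S) es st :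
  {in es, forall e st', I st' -> I (f st' e)} -> I st -> I (foldl f st es).
Proof.
elim: es st => //= e es IH st fI Ist; apply: IH => [e' e'es|].
  by apply: fI; rewrite inE e'es orbT.
by apply: fI; rewrite ?inE ?eqxx.
Qed.

Lemma iter_invariant S (I : S -> Prop) (f : S -> S) n st :
  (forall st', I st' -> I (f st')) -> I st -> I (iter n f st).
Proof. by move=> fI Ist; elim: n => //= n; apply: fI. Qed.

End EdgeSets.

Section Algorithm.
Variables (n : nat) (nb : nat -> nat -> nat).

Definition edges : seq (nat * nat) := [seq (v, i) | v <- iota 0 n, i <- iota 0 5].

(** The state is a tree, given by the table of its vertices and the set of its
    edges. *)
Definition tree_step (st : seq bool * seq (seq bool)) (e : nat * nat) :=
  let w := nb e.1 e.2 in
  if nth false st.1 e.1 && ~~ nth false st.1 w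
  then (set_nth false st.1 w true, mark st.2 e.1 e.2) else st.

(** (v, a), (w, i) and (v, c) are the sides of the triangle based at v that spells
    s_(i+3) s_i = s_(i+4). *)
Definition triangle_step (K : seq (seq bool)) (e : nat * nat) :=
  let: (v, i) := e in
  let a := ((i + 3) %% 5)%N in let c := ((i + 4) %% 5)%N in let w := nb v a in
  match known K v a, known K w i, known K v c with
  | true, true, false => mark K v c
  | true, false, true => mark K w i
  | false, true, true => mark K v a
  | _, _, _ => K
  end.

Definition spanning_tree (root rounds : nat) : seq bool * seq (seq bool) :=
  iter rounds (fun st => foldl tree_step st edges) (set_nth false [::] root true, [::]).

Definition saturate (rounds : nat) (K : seq (seq bool)) : seq (seq bool) :=
  iter rounds (fun K' => foldl triangle_step K' edges) K.

(** If two sides of a triangle are homotopic to paths in the tree, then so is the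
    third. So this test certifies that the tree spans the complex and that every
    loop is contractible. *)
Definition simply_connected (root r r' : nat) : bool :=
  let t := spanning_tree root r in let K := saturate r' t.2 in
  all (nth false t.1) (iota 0 n) && all (fun e => known K e.1 e.2) edges.

End Algorithm.

(** In this section the vertices of the Cayley graph of G are numbered by idx,
    and nb is the resulting table of right translations by the s i. *)
Section CayleyComplex.
Variables (G : finGroupType) (s : 'I_5 -> G).
Variables (n : nat) (nb : nat -> nat -> nat) (idx : G -> nat) (r r' : nat).
Hypothesis s_triangle : forall i, (s (i + 3) * s i)%g = s (i + 4).
Hypothesis idx_inj : injective idx.
Hypothesis idx_onto : forall v, (v < n)%N <-> exists g, idx g = v.
Hypothesis nb_idx : forall g (i : 'I_5), nb (idx g) i = idx (g * s i)%g.
Hypothesis checked : simply_connected n nb (idx 1%g) r r'.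

Let idx_lt g : (idx g < n)%N. Proof. by apply/idx_onto; exists g. Qed.

Lemma edgesP e : reflect (exists g (i : 'I_5), e = (idx g, val i)) (e \in edges n).
Proof.
apply: (iffP allpairsP) => [[[v i] []]|[g [i ->]]].
  rewrite mem_iota => /idx_onto[g <-]; rewrite mem_iota => i5 ->.
  by exists g, (Ordinal i5).
by exists (idx g, val i); split; rewrite // mem_iota ?idx_lt ?ltn_ord.
Qed.

Section Connected.
Variable Q : G -> Prop.
Hypotheses (Q1 : Q 1%g) (Qs : forall g i, Q g -> Q (g * s i)%g).

(** The spanning tree reaches every vertex from 1. *)
Lemma Cayley_connected g : Q g.
Proof.
have [/allP vis _] := andP checked.
have {vis}: nth false (spanning_tree n nb (idx 1%g) r).1 (idx g).
  by apply: vis; rewrite mem_iota idx_lt.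
pose I (st : seq bool * seq (seq bool)) :=
  forall h, nth false st.1 (idx h) -> Q h.
suff: I (spanning_tree n nb (idx 1%g) r) by apply.
apply: (@iter_invariant _ I) => [st Ist|h]; last first.
  by rewrite nth_set_nth /= nth_nil; case: eqP => // /idx_inj ->.
apply: (@foldl_invariant _ _ I) Ist => _ /edgesP[h [i ->]] st' Ist.
rewrite /tree_step /= nb_idx; case: ifP => // /andP[vh _] k /=.
rewrite nth_set_nth /=; case: eqP => [/idx_inj-> _|_]; last exact: Ist.
exact/Qs/Ist.
Qed.

End Connected.

(** The coefficients of the cocycle f are T modulo the subgroup P. *)
Section Coboundary.
Variables (T : zmodType) (P : T -> Prop) (f : G -> 'I_5 -> T).
Hypotheses (P0 : P 0) (PB : forall x y, P x -> P y -> P (x - y)).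
Hypothesis f_cocycle : forall g i,
  P (f g (i + 3) + f (g * s (i + 3))%g i - f g (i + 4)).

Let defect (D : G -> T) g i := f g i - (D (g * s i)%g - D g).

Let explained D (K : seq (seq bool)) :=
  forall g (i : 'I_5), known K (idx g) i -> P (defect D g i).

Let PD x y : P x -> P y -> P (x + y).
Proof. by move=> Px Py; rewrite -[y]opprK -[- y]sub0r; do !apply: PB. Qed.

Let P_third x y z : P (x + y - z) ->
  [/\ P x -> P y -> P z, P x -> P z -> P y & P y -> P z -> P x].
Proof.
move=> Pxyz; split=> Pl Pr.
- by rewrite -[z](subKr (x + y)); apply: PB => //; apply: PD.
- by rewrite -[y](addKr x) -[_ + y](subrK z) addrC; apply: PB => //; apply: PD.
- by rewrite -[x](addrK y) -[x + y](subrK z); apply: PB => //; apply: PD.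
Qed.

(** A new edge ends at a vertex that no edge of the tree has met, so the value of
    the potential there can be chosen to fit this edge. *)
Lemma spanning_tree_explained :
  exists D, explained D (spanning_tree n nb (idx 1%g) r).2.
Proof.
pose I (st : seq bool * seq (seq bool)) :=
  (forall g (i : 'I_5), known st.2 (idx g) i ->
     nth false st.1 (idx g) && nth false st.1 (idx (g * s i)%g)) /\
  exists D, explained D st.2.
suff: I (spanning_tree n nb (idx 1%g) r) by case.
apply: (@iter_invariant _ I) => [st Ist|]; last first.
  by split=> [g i|]; [|exists (fun=> 0) => g i]; rewrite /known nth_nil nth_nil.
apply: (@foldl_invariant _ _ I) Ist => _ /edgesP[h [i ->]] st' [vis [D DP]].
rewrite /tree_step /= nb_idx; case: ifP => [/andP[vh nvw]|_]; last by split; [|exists D].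
split.
  move=> g j /=; rewrite known_mark !nth_set_nth /= => /orP[|/vis/andP[-> ->]].
    by case/andP=> /eqP/idx_inj-> /eqP/val_inj->; rewrite vh eqxx if_same.
  by rewrite !if_same.
exists (fun g => if g == (h * s i)%g then D h + f h i else D g) => g j /=.
have hw : (h == h * s i)%g = false.
  by apply: contraNF nvw => /eqP <-.
rewrite known_mark => /orP[/andP[/eqP/idx_inj-> /eqP/val_inj->]|kgj].
  by rewrite /defect eqxx hw [D h + _]addrC addrK subrr.
have [vg vgj] := andP (vis _ _ kgj).
have old x : nth false st'.1 (idx x) -> (x == h * s i)%g = false.
  by move=> vx; apply: contraNF nvw => /eqP <-.
by rewrite /defect !old //; apply: DP.
Qed.

(** A coboundary satisfies the cocycle condition exactly, so the defect inherits
    it from f. *)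
Lemma triangle_defect D g i :
  P (defect D g (i + 3) + defect D (g * s (i + 3))%g i - defect D g (i + 4)).
Proof.
have := f_cocycle g i; congr P; rewrite /defect -mulgA s_triangle.
rewrite ![f _ _ - _]addrC !opprB.
set x := D g; set y := D (g * _)%g; set z := D (g * _)%g.
by rewrite addrACA subrKA opprD opprB addrACA subrKA subrr add0r.
Qed.

Lemma triangle_step_explained D K e :
  e \in edges n -> explained D K -> explained D (triangle_step nb K e).
Proof.
case/edgesP=> g [i ->] KD.
have valD (k : 'I_5) m : ((k + m) %% 5)%N = val (k + m%:R).
  by rewrite /= Zp_nat /= modnDmr.
rewrite /triangle_step !valD nb_idx.
have markD h j : P (defect D h j) -> explained D (mark K (idx h) (val j)).
  move=> Phj h' j'; rewrite known_mark => /orP[|/KD //].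
  by case/andP=> /eqP/idx_inj-> /eqP/val_inj->.
have [pc pb pa] := P_third (triangle_defect D g i).
case: ifP => ka; case: ifP => kb //; case: ifP => kc //.
- by apply: (markD g (i + 4)); apply: pc; apply: KD.
- by apply: (markD _ i); apply: pb; apply: KD.
- by apply: (markD g (i + 3)); apply: pa; apply: KD.
Qed.

(** The vanishing of the first cohomology of the Cayley 2-complex: the potential
    found along the tree stays correct on each side that a triangle adds, and in
    the end all edges are known. *)
Lemma cocycle_is_coboundary :
  exists D : G -> T, forall g i, P (f g i - (D (g * s i)%g - D g)).
Proof.
have [D DP] := spanning_tree_explained; exists D => g i.
have [_ /allP kn] := andP checked.
suff: explained D (saturate n nb r' (spanning_tree n nb (idx 1%g) r).2).
  by apply; apply: (kn (idx g, val i)); apply/edgesP; exists g, i.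
apply: (@iter_invariant _ (explained D)) DP => K KD.
apply: (@foldl_invariant _ _ (explained D)) KD => e en K' K'D.
exact: triangle_step_explained.
Qed.

End Coboundary.

End CayleyComplex.

(** * Integral group rings and images of matrices *)

Section GroupRing.
Variable G : finGroupType.
Local Notation A := (Zgroup_ring G).

Lemma gr_mul_elt (a : A) h g : (a * gr_elt h) g = a (g * h^-1)%g.
Proof.
rewrite [LHS]gr_mulE (bigD1 (g * h^-1)%g) //= big1 => [|k kgh].
  by rewrite ffunE invMg invgK mulgKV eqxx mulr1 addr0.
rewrite ffunE; case: eqP => [kh|_]; last by rewrite mulr0.
by case/eqP: kgh; rewrite -kh invMg invgK mulKVg.
Qed.

Lemma gr_mul_subr1 (a : A) h g : (a * (gr_elt h - 1)) g = a (g * h^-1)%g - a g.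
Proof. by rewrite mulrBr mulr1 -gr_mul_elt [LHS]ffunE [X in _ + X]ffunE. Qed.

Lemma gr_expand (a : A) : a = \sum_g gr_elt g *~ a g.
Proof.
apply/ffunP=> h; rewrite sum_ffunE (bigD1 h) //= big1 => [|g gh].
  by rewrite ffunMzE ffunE eqxx addr0 intz.
by rewrite ffunMzE ffunE eq_sym (negPf gh) mul0rz.
Qed.

Definition gr_norm : A := \sum_g gr_elt g.

Lemma gr_normE g : gr_norm g = 1.
Proof.
rewrite /gr_norm sum_ffunE (bigD1 g) //= big1 => [|h hg]; rewrite ffunE.
  by rewrite eqxx addr0.
by rewrite eq_sym (negPf hg).
Qed.

Lemma mul_gr_norm (a : A) : a * gr_norm = gr_norm *~ augmentation a.
Proof.
apply/ffunP=> g; rewrite [LHS]gr_mulE ffunMzE gr_normE intz.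
by apply: eq_bigr => h _; rewrite gr_normE mulr1.
Qed.

Lemma augmentation_onto (c : int) : exists a : A, augmentation a = c.
Proof.
exists [ffun g => c *+ (g == 1%g)].
rewrite /augmentation (bigD1 1%g) //= ffunE eqxx big1 ?addr0 // => h /negPf h1.
by rewrite ffunE h1.
Qed.

End GroupRing.

Section Image.
Variables (A : nzRingType) (m n : nat) (d : 'M[A]_(m, n)).

Definition in_image (x : 'rV[A]_n) : Prop := exists u, u *m d = x.

Lemma in_image0 : in_image 0.
Proof. by exists 0; rewrite mul0mx. Qed.

Lemma in_imageB x y : in_image x -> in_image y -> in_image (x - y).
Proof. by move=> [u <-] [v <-]; exists (u - v); rewrite mulmxBl. Qed.

Lemma in_imageD x y : in_image x -> in_image y -> in_image (x + y).
Proof. by move=> [u <-] [v <-]; exists (u + v); rewrite mulmxDl. Qed.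

Lemma in_image_sum (I : finType) (x : I -> 'rV[A]_n) (c : I -> int) :
  (forall i, in_image (x i)) -> in_image (\sum_i x i *~ c i).
Proof.
move=> dx; elim/big_rec: _ => [|i y _ dy]; first exact: in_image0.
apply: in_imageD => //; have [u <-] := dx i.
by exists (u *~ c i); apply: (raddfMz (mulmxr d)).
Qed.

End Image.

(** * Exactness from connectedness, vanishing cohomology and self-duality *)

Section Complex.
Variables (G : finGroupType) (s : 'I_5 -> G).
Local Notation A := (Zgroup_ring G).

Definition cyc_d1 : 'M[A]_(5, 1) := \col_i (gr_elt (s i) - 1).

Definition cyc_d2 : 'M[A]_5 := \matrix_(i, k)
  (gr_elt (s (i + 3)) * (k == i)%:R + (k == i + 3)%:R - (k == i + 4)%:R).

Definition cyc_d3 : 'M[A]_(1, 5) := \row_i (gr_elt (s (i + 1)) - 1).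

Definition cyc_d4 : 'M[A]_(1, 1) := const_mx (gr_norm G).

Lemma mul_cyc_d1 (v : 'rV[A]_5) g :
  (v *m cyc_d1) 0 0 g = \sum_i (v 0 i (g * (s i)^-1)%g - v 0 i g).
Proof.
rewrite mxE sum_ffunE; apply: eq_bigr => i _.
by rewrite mxE gr_mul_subr1.
Qed.

Lemma mul_cyc_d2 (v : 'rV[A]_5) k :
  (v *m cyc_d2) 0 k = v 0 k * gr_elt (s (k + 3)) + v 0 (k + 2) - v 0 (k + 1).
Proof.
have shift (j c : 'I_5) : (c + j = 0) ->
    \sum_i v 0 i * (k == i + c)%:R = v 0 (k + j).
  move=> cj; rewrite (bigD1 (k + j)) //= big1 => [|i ikj].
    by rewrite -addrA [j + c]addrC cj !addr0 eqxx mulr1.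
  case: eqP => [kic|_]; last by rewrite mulr0.
  by case/eqP: ikj; rewrite kic -addrA cj addr0.
rewrite mxE -(shift 2 3) -?(shift 1 4); try exact: val_inj.
rewrite -sumrN; under eq_bigr do rewrite mxE mulrBr mulrDr.
rewrite sumrB big_split /= sumrN; congr (_ + _ - _).
rewrite (bigD1 k) //= eqxx mulr1 big1 ?addr0 // => i /negPf ik.
by rewrite eq_sym ik !mulr0.
Qed.

Lemma mul_cyc_d2E (v : 'rV[A]_5) k g : (v *m cyc_d2) 0 k g =
  v 0 k (g * (s (k + 3))^-1)%g + v 0 (k + 2) g - v 0 (k + 1) g.
Proof.
by rewrite mul_cyc_d2 -gr_mul_elt [LHS]ffunE [X in X + _]ffunE [X in _ + X]ffunE.
Qed.

Lemma mul_cyc_d3 (u : 'rV[A]_1) i g :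
  (u *m cyc_d3) 0 i g = u 0 0 (g * (s (i + 1))^-1)%g - u 0 0 g.
Proof. by rewrite mxE big_ord1 mxE gr_mul_subr1. Qed.

Lemma mul_cyc_d4 (u : 'rV[A]_1) g : (u *m cyc_d4) 0 0 g = augmentation (u 0 0).
Proof. by rewrite mxE big_ord1 mxE mul_gr_norm ffunMzE gr_normE intz. Qed.

Hypothesis s_triangle : forall i, (s (i + 3) * s i)%g = s (i + 4).
Hypothesis connected : forall Q : G -> Prop,
  Q 1%g -> (forall g i, Q g -> Q (g * s i)%g) -> forall g, Q g.
Hypothesis coboundary : forall (T : zmodType) (P : T -> Prop) (f : G -> 'I_5 -> T),
  P 0 -> (forall x y, P x -> P y -> P (x - y)) ->
  (forall g i, P (f g (i + 3) + f (g * s (i + 3))%g i - f g (i + 4))) ->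
  exists D : G -> T, forall g i, P (f g i - (D (g * s i)%g - D g)).
Variable q : G.
Hypothesis dual : forall i, (s (1 - i) * q * s i)%g = q.

Let s_triangle' i : (s i * s (i + 2))%g = s (i + 1).
Proof.
have [e3 e4] : 2 + 3 = 0 :> 'I_5 /\ 2 + 4 = 1 :> 'I_5 by split; apply: val_inj.
by have := s_triangle (i + 2); rewrite -!(addrA i) e3 e4 addr0.
Qed.

(** The elements g - 1 span the augmentation ideal, and g s_i - 1 is the sum of
    g - 1 and g (s_i - 1). *)
Lemma exact_at0 (v : 'rV[A]_1) : augmentation (v 0 0) = 0 <-> in_image cyc_d1 v.
Proof.
split=> [v0|[u <-]]; last first.
  rewrite /augmentation; under eq_bigr do rewrite mul_cyc_d1.
  rewrite exchange_big big1 //= => i _; rewrite sumrB.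
  by rewrite [X in _ - X](reindex_inj (mulIg (s i)^-1%g)) subrr.
have dg : forall g, in_image cyc_d1 (gr_elt g - 1)%:M.
  apply: connected => [|g i [u ug]].
    by rewrite subrr raddf0; apply: in_image0.
  exists (u + gr_elt g *: delta_mx 0 i).
  rewrite mulmxDl ug -scalemxAl -rowE; apply/rowP => j.
  rewrite !mxE !ord1 eqxx !mulr1n gr_eltM mulrBr mulr1 addrC.
  by rewrite addrA subrK.
have -> : v = \sum_g (gr_elt g - 1)%:M *~ v 0 0 g; last exact: in_image_sum.
under eq_bigr do rewrite -(raddfMz (@scalar_mx _ 1)).
rewrite -raddf_sum; apply/rowP=> j; rewrite ord1 mxE eqxx mulr1n.
under eq_bigr do rewrite mulrzBl.
by rewrite sumrB -gr_expand -mulrz_sumr -/(augmentation _) v0 subr0.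
Qed.

Lemma row_cyc_d2 i : row i cyc_d2 =
  gr_elt (s (i + 3)) *: delta_mx 0 i + delta_mx 0 (i + 3) - delta_mx 0 (i + 4).
Proof. by apply/rowP=> k; rewrite !mxE !eqxx. Qed.

Lemma mul_cyc_d2_d1 : cyc_d2 *m cyc_d1 = 0.
Proof.
apply/row_matrixP=> i; rewrite row_mul row_cyc_d2 mulmxBl mulmxDl -scalemxAl.
rewrite -!rowE row0; apply/rowP=> j; rewrite !mxE.
by rewrite mulrBr mulr1 -gr_eltM s_triangle addrA subrK opprB addrA subrK subrr.
Qed.

(** In the cokernel of d2 let g e_i = D (g s_i) - D g. Then a chain v equals there
    the image of v d1 under the additive extension of D, which is 0 for a
    cycle. *)
Lemma exact_at1 (v : 'rV[A]_5) : v *m cyc_d1 = 0 <-> in_image cyc_d2 v.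
Proof.
split=> [v0|[u <-]]; last by rewrite -mulmxA mul_cyc_d2_d1 mulmx0.
pose f g i : 'rV[A]_5 := gr_elt g *: delta_mx 0 i.
have [||g i|D fD] := coboundary (P := in_image cyc_d2) (f := f).
- exact: in_image0.
- exact: in_imageB.
- exists (f g i); rewrite -scalemxAl -rowE row_cyc_d2 scalerBr scalerDr scalerA.
  by rewrite -gr_eltM [X in X - _]addrC.
have -> : v = \sum_(p : 'I_5 * G)
    (f p.2 p.1 - (D (p.2 * s p.1)%g - D p.2)) *~ v 0 p.1 p.2; last first.
  exact: in_image_sum.
under eq_bigr do rewrite mulrzBl.
rewrite sumrB [X in _ - X](_ : _ = 0) ?subr0; last first.
  rewrite -(pair_bigA _ (fun i g => (D (g * s i)%g - D g) *~ v 0 i g)) /=.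
  (* Summation by parts: the coefficient of D g becomes (v d1) g. *)
  transitivity (\sum_i \sum_g D g *~ (v 0 i (g * (s i)^-1)%g - v 0 i g)).
    apply: eq_bigr => i _; under eq_bigr do rewrite mulrzBl.
    rewrite sumrB (reindex_inj (mulIg (s i)^-1%g)) /= -sumrB.
    by apply: eq_bigr => g _; rewrite mulgKV mulrzBr.
  rewrite exchange_big big1 //= => g _.
  by rewrite -mulrz_sumr -mul_cyc_d1 v0 mxE ffunE.
rewrite -(pair_bigA _ (fun i g => f g i *~ v 0 i g)) /= [LHS]row_sum_delta.
apply: eq_bigr => i _; rewrite [X in X *: _]gr_expand scaler_suml.
by apply: eq_bigr => g _; rewrite scalerMzl.
Qed.

Lemma mul_cyc_d3_d2 : cyc_d3 *m cyc_d2 = 0.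
Proof.
apply/rowP=> k; rewrite mul_cyc_d2 !mxE mulrBl mul1r -gr_eltM.
have [e1 e2] : 1 + 1 = 2 :> 'I_5 /\ 1 + 2 = 3 :> 'I_5 by split; apply: val_inj.
have e3 : 2 + 1 = 3 :> 'I_5 by apply: val_inj.
have := s_triangle' (k + 1); rewrite -!(addrA k) e1 e2 e3 => ->.
by rewrite addrA subrK opprB addrA subrK subrr.
Qed.

Lemma dual_conj i : (s i * q^-1 = q^-1 * (s (1 - i))^-1)%g.
Proof. by rewrite -[in LHS](dual i) !invMg mulKVg. Qed.

(** At the element g, column k of the equation v d2 = 0 reads
    v_k (g s_(k+3)^-1) + v_(k+2) g - v_(k+1) g = 0. This is the cocycle condition
    for the tuple t_i = s_(1-i)^-1 = q s_i q^-1 and the function v_(-i) on the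
    edges labelled i. Likewise u d3 = v says that v_(-i) is the coboundary of u
    for the tuple t. Right translation by q leads back to the tuple s. *)
Lemma exact_at2 (v : 'rV[A]_5) : v *m cyc_d2 = 0 <-> in_image cyc_d3 v.
Proof.
split=> [v0|[u <-]]; last by rewrite -mulmxA mul_cyc_d3_d2 mulmx0.
pose f g i : int := v 0 (- i) (g * q^-1)%g.
have [|_ _ -> ->|g i|D fD] := coboundary (P := fun x => x = 0) (f := f) => //.
- have := mul_cyc_d2E v (- i) (g * q^-1)%g; rewrite v0 mxE ffunE.
  have [e2 e1] : - 3 = 2 :> 'I_5 /\ - 4 = 1 :> 'I_5 by split; apply: val_inj.
  have e3 : 1 - (i + 3) = - i + 3.
    by rewrite opprD e2 addrCA; congr (_ + _); apply: val_inj.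
  by rewrite /f -!mulgA dual_conj e3 !(opprD i) e2 e1 [v 0 (- i + 2) _ + _]addrC => <-.
exists (const_mx [ffun g => D (g * q)%g]).
apply/rowP=> i; apply/ffunP=> g; rewrite mul_cyc_d3 !mxE !ffunE.
have := fD (g * q)%g (- i); rewrite /f opprK mulgK => /subr0_eq ->.
congr (D _ - _); rewrite -[X in (_ * X)%g = _](dual (- i)) opprK [1 + i]addrC.
by rewrite -!mulgA mulKg.
Qed.

(** The kernel of d3 consists of the functions on G that are invariant under right
    translation by the s i, which are constant by connectedness. *)
Lemma exact_at3 (u : 'rV[A]_1) : u *m cyc_d3 = 0 <-> in_image cyc_d4 u.
Proof.
split=> [u0|[w <-]]; last first.
  apply/rowP=> i; apply/ffunP=> g.
  by rewrite mul_cyc_d3 !mul_cyc_d4 subrr mxE ffunE.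
have const : forall g, u 0 0 g = u 0 0 1%g.
  apply: connected => // g i <-; apply/esym/eqP; rewrite -subr_eq0.
  have := mul_cyc_d3 u (i - 1) (g * s i)%g.
  by rewrite subrK mulgK u0 mxE ffunE => <-.
have [a au] := augmentation_onto G (u 0 0 1%g); exists (const_mx a).
by apply/rowP=> i; apply/ffunP=> g; rewrite ord1 mul_cyc_d4 const mxE.
Qed.

(** Since w N = epsilon(w) N, the kernel of d4 is that of the augmentation. *)
Lemma exact_at4 (w : 'rV[A]_1) : w *m cyc_d4 = 0 <-> in_image cyc_d1 w.
Proof.
rewrite -exact_at0; split=> [w0|w0].
  by rewrite -(mul_cyc_d4 w 1%g) w0 mxE ffunE.
by apply/rowP=> i; apply/ffunP=> g; rewrite ord1 mul_cyc_d4 w0 mxE ffunE.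
Qed.

End Complex.

(** * The binary icosahedral group *)

Definition gquat_prod (p q : gquat) : gquat := gquat_half (gquat_mul p q).

Definition exact_prod (p q : gquat) : bool :=
  gquat_double (gquat_prod p q) == gquat_mul p q.

Definition gquat_gens : seq gquat :=
  [:: gquat_sigma_k false; gquat_sigma_i false; gquat_sigma_j false;
      gquat_sigma_j true; gquat_sigma_i true].

Definition Cayley_table (l : seq gquat) : seq (seq nat) :=
  [seq [seq index (gquat_prod p g) l | g <- gquat_gens] | p <- l].

Definition table_nb (t : seq (seq nat)) (v i : nat) : nat := nth 0%N (nth [::] t v) i.

(** The numbers of rounds are those after which the tree and then the set of
    known edges stop growing. *)
Definition icos_check (l : seq gquat) : bool :=
  all (fun p => all (exact_prod p) gquat_gens) l &&
  simply_connected 120 (table_nb (Cayley_table l)) (index gquat_1 l) 3 7.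

Lemma icos_checked : icos_check gquat_icos.
Proof. by rewrite gquat_icos.unlock; vm_compute. Qed.

(** The s_i are rotations by the same angle, and their axes are spaced evenly
    around an axis of fivefold symmetry. This quaternion is a half-turn about an
    axis perpendicular to the latter: it sends the axis of s_i to the opposite of
    that of s_(1-i). *)
Definition gquat_turn : gquat := ((0, 0), (-1, 1), (0, -1), (1, 0)).

Lemma gquat_turn_icos : gquat_turn \in gquat_icos.
Proof. by rewrite gquat_icos.unlock; vm_compute. Qed.

Definition gquat_gen (i : 'I_5) : gquat := nth gquat_1 gquat_gens i.

Section Icosahedral.
Variable R : realType.

Definition icos_gen (i : 'I_5) : icos R :=
  nth 1%g [:: sigma_k R false; sigma_i R false; sigma_j R false;
              sigma_j R true; sigma_i R true] i.

Definition represents (p : gquat) (g : icos R) : Prop := gquat_val R p = uquat_val g.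

Lemma represents_inj p g h : represents p g -> represents p h -> g = h.
Proof. by rewrite /represents => -> e; do 2!apply: val_inj. Qed.

Lemma represents_mul p q g h : exact_prod p q ->
  represents p g -> represents q h -> represents (gquat_prod p q) (g * h)%g.
Proof. by move=> /eqP e pg qh; rewrite /represents -(gquat_valM R e) pg qh. Qed.

Lemma represents_gen (i : 'I_5) : represents (gquat_gen i) (icos_gen i).
Proof.
by case: i => [[|[|[|[|[|//]]]]] lti]; congr Quat;
  rewrite /gold_val ?phi_inv /=; field.
Qed.

Lemma icos_represented g : exists2 p, p \in gquat_icos & represents p g.
Proof. by have /mapP[p pI e] := icos_val_quat_icos g; exists p. Qed.

Lemma gquat_icos_represents p : p \in gquat_icos -> exists g, represents p g.
Proof.
move=> pI; have [|x xG ex] := @quat_icos_generated R (gquat_val R p).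
  exact: map_f.
by exists (Icos xG).
Qed.

Definition icos_index (g : icos R) : nat := index (uquat_val g) (quat_icos R).

Lemma represents_index p g : represents p g -> icos_index g = index p gquat_icos.
Proof. by rewrite /icos_index => <-; apply/index_map/gquat_val_inj. Qed.

Lemma icos_index_inj : injective icos_index.
Proof.
move=> g h; have [p pI pg] := icos_represented g; have [q qI qh] := icos_represented h.
rewrite (represents_index pg) (represents_index qh) => e.
apply: represents_inj pg _; congr (represents _ _): qh.
by rewrite -(nth_index gquat_1 pI) e nth_index.
Qed.

Lemma icos_index_onto v : (v < 120)%N <-> exists g, icos_index g = v.
Proof.
rewrite -size_gquat_icos; split=> [vlt|[g <-]]; last first.
  by have [p pI pg] := icos_represented g; rewrite (represents_index pg) index_mem.
have [g pg] := gquat_icos_represents (mem_nth gquat_1 vlt).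
by exists g; rewrite (represents_index pg) index_uniq ?gquat_icos_uniq.
Qed.

Lemma exact_prod_gen p i : p \in gquat_icos -> (i < 5)%N ->
  exact_prod p (nth gquat_1 gquat_gens i).
Proof.
by case/andP: icos_checked => /allP ex _ /ex/allP pex i5; apply: pex; apply: mem_nth.
Qed.

Lemma Cayley_table_icos g (i : 'I_5) :
  table_nb (Cayley_table gquat_icos) (icos_index g) i = icos_index (g * icos_gen i)%g.
Proof.
have [p pI pg] := icos_represented g.
have pgi := represents_mul (exact_prod_gen pI (ltn_ord i)) pg (represents_gen i).
rewrite (represents_index pgi).
rewrite (represents_index pg) /table_nb (nth_map gquat_1) ?index_mem // nth_index //.
by rewrite (nth_map gquat_1) ?ltn_ord.
Qed.

Lemma icos_index_checked : simply_connected 120 (table_nb (Cayley_table gquat_icos))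
  (icos_index 1%g) 3 7.
Proof.
rewrite (@represents_index gquat_1) ?(gquat_val_1 R) //; last exact: gquat_val_1.
by case/andP: icos_checked.
Qed.

Lemma icos_gen_triangle i :
  (icos_gen (i + 3) * icos_gen i)%g = icos_gen (i + 4).
Proof.
apply: (represents_inj (p := gquat_gen (i + 4))); last exact: represents_gen.
have: exact_prod (gquat_gen (i + 3)) (gquat_gen i)
  by case: i => [[|[|[|[|[|//]]]]] lti].
move/represents_mul/(_ (represents_gen _) (represents_gen _)); congr represents.
by case: i => [[|[|[|[|[|//]]]]] lti].
Qed.

Lemma icos_gen_dual :
  exists q, forall i, (icos_gen (1 - i) * q * icos_gen i)%g = q.
Proof.
have [q pq] := gquat_icos_represents gquat_turn_icos; exists q => i.
apply: (represents_inj _ pq).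
have e1 : exact_prod (gquat_gen (1 - i)) gquat_turn by case: i => [[|[|[|[|[|//]]]]] lti].
have e2 : exact_prod (gquat_prod (gquat_gen (1 - i)) gquat_turn) (gquat_gen i)
  by case: i {e1} => [[|[|[|[|[|//]]]]] lti].
have := represents_mul e2 (represents_mul e1 (represents_gen _) pq) (represents_gen _).
by congr represents; case: i {e1 e2} => [[|[|[|[|[|//]]]]] lti].
Qed.

Lemma icos_d1E : icos_d1 R = cyc_d1 icos_gen.
Proof. by apply/matrixP=> -[[|[|[|[|[|//]]]]] lti] j; rewrite !mxE !ord1. Qed.

(** For arbitrary entries, so that the comparison of the zero patterns involves no
    computation in the group ring. *)
Lemma circulant_rows (A : nzRingType) (x0 x1 x2 x3 x4 : A) :
  mx_of_rows 5 5 [:: [:: x0; 0; 0; 1; -1];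
                     [:: -1; x1; 0; 0; 1];
                     [:: 1; -1; x2; 0; 0];
                     [:: 0; 1; -1; x3; 0];
                     [:: 0; 0; 1; -1; x4]] =
  \matrix_(i, k) ([:: x0; x1; x2; x3; x4]`_i * (k == i)%:R
                  + (k == i + 3)%:R - (k == i + 4)%:R).
Proof.
by apply/matrixP=> -[[|[|[|[|[|//]]]]] lti] [[|[|[|[|[|//]]]]] ltj];
  rewrite !mxE /= ?(mulr1, mulr0, add0r) ?(addr0, subr0) ?oppr0.
Qed.

Lemma icos_d2E : icos_d2 R = cyc_d2 icos_gen.
Proof.
rewrite [LHS]circulant_rows; apply/matrixP=> i k; rewrite [LHS]mxE [RHS]mxE.
congr (_ * _ + _ - _); case: i => [[|[|[|[|[|//]]]]] lti]; rewrite /=;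
  congr gr_elt; exact: (congr1 icos_gen (val_inj erefl)).
Qed.

Lemma icos_d3E : icos_d3 R = cyc_d3 icos_gen.
Proof. by apply/matrixP=> i [[|[|[|[|[|//]]]]] ltj]; rewrite !mxE !ord1. Qed.

Lemma icos_d4E : icos_d4 R = cyc_d4 (icos R).
Proof. by apply/matrixP=> i j; rewrite !mxE !ord1. Qed.

Lemma icos_connected (Q : icos R -> Prop) :
  Q 1%g -> (forall g i, Q g -> Q (g * icos_gen i)%g) -> forall g, Q g.
Proof.
exact: (Cayley_connected icos_index_inj icos_index_onto Cayley_table_icos
  icos_index_checked).
Qed.

Lemma icos_coboundary (T : zmodType) (P : T -> Prop) (f : icos R -> 'I_5 -> T) :
  P 0 -> (forall x y, P x -> P y -> P (x - y)) ->
  (forall g i, P (f g (i + 3) + f (g * icos_gen (i + 3))%g i - f g (i + 4))) ->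
  exists D : icos R -> T, forall g i, P (f g i - (D (g * icos_gen i)%g - D g)).
Proof.
exact: (cocycle_is_coboundary icos_gen_triangle icos_index_inj icos_index_onto
  Cayley_table_icos icos_index_checked).
Qed.

Lemma icos_exact n (v : 'rV[Zgroup_ring (icos R)]_(icos_rank n.+1)) :
  v *m icos_d R n = 0 <-> exists u, u *m icos_d R n.+1 = v.
Proof.
have [q dual] := icos_gen_dual.
pose E m := forall w : 'rV[Zgroup_ring (icos R)]_(icos_rank m.+1),
  w *m icos_d R m = 0 <-> exists u, u *m icos_d R m.+1 = w.
suff: [/\ E n, E n.+1, E n.+2 & E n.+3] by case=> En _ _ _; apply: En.
elim: n {v} => [|n [E0 E1 E2 E3]]; last by split.
split=> w /=.
- rewrite icos_d1E icos_d2E.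
  exact: (exact_at1 icos_gen_triangle icos_coboundary).
- rewrite icos_d2E icos_d3E.
  exact: (exact_at2 icos_gen_triangle icos_coboundary dual).
- by rewrite icos_d3E icos_d4E; apply: (exact_at3 icos_connected).
- by rewrite icos_d4E icos_d1E; apply: (exact_at4 icos_connected).
Qed.

Lemma icos_periodic : periodic_complex 4 (icos_d R).
Proof.
have E n : icos_rank (n + 4) = icos_rank n by rewrite addnC.
have d_shift n m (mn : m = n.+4) (e1 : icos_rank m.+1 = icos_rank n.+1)
    (e2 : icos_rank m = icos_rank n) : castmx (e1, e2) (icos_d R m) = icos_d R n.
  rewrite mn in e1 e2 *.
  by rewrite (eq_irrelevance e1 erefl) (eq_irrelevance e2 erefl) castmx_id.
by exists E => n; apply: (d_shift n (n + 4)%N (addnC n 4) (E n.+1) (E n)).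
Qed.

End Icosahedral.

Theorem corollary5p3p3 (R : realType) :
  free_resolution (icos_d R) (icos_aug R) /\ periodic_complex 4 (icos_d R).
Proof.
split; last exact: icos_periodic.
split=> [x|v|n v]; last exact: icos_exact.
  by have [a ax] := augmentation_onto (icos R) x; exists (const_mx a);
    rewrite /= /aug_row mxE.
have := exact_at0 (@icos_connected R) v; rewrite -icos_d1E.
exact.
Qed.
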